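(* Let $\mathbb{K}$ be a field and let $\mathcal{S}\subsetneq\mathbb{N}$ be a numerical semigroup. The toric ideal $I_{\mathcal{S}}$ is generalized robust if and only if $\mathcal{S}$ has a unique Betti element.
   Context: A numerical semigroup is a submonoid $\mathcal{S}$ of $(\mathbb{N},+)$ with finite complement; it has a unique minimal generating set $A=\{a_1,\ldots,a_m\}\subseteq\mathbb{Z}^+$, which is finite. For $\mathbf{u}\in\mathbb{N}^m$ put $\deg_A(\mathbf{x}^{\mathbf{u}})=\sum_i u_ia_i$. The toric ideal $I_{\mathcal{S}}\subseteq\mathbb{K}[x_1,\ldots,x_m]$ is generated by all binomials $\mathbf{x}^{\mathbf{u}}-\mathbf{x}^{\mathbf{v}}$ with $\deg_A(\mathbf{x}^{\mathbf{u}})=\deg_A(\mathbf{x}^{\mathbf{v}})$; the $A$-degree of such a binomial is this common value. A Markov basis is a minimal generating set of $I_{\mathcal{S}}$ consisting of binomials; the universal Markov basis is the union of all Markov bases; the universal Gröbner basis is the union of all reduced Gröbner bases over all monomial orders. Binomials are considered up to sign. $I_{\mathcal{S}}$ is generalized robust if its universal Gröbner basis equals its universal Markov basis. $\mathcal{S}$ has a unique Betti element if the $A$-degrees of all the binomials in a Markov basis of $I_{\mathcal{S}}$ coincide (the $A$-degrees occurring do not depend on the Markov basis). *)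

(* Defs.v *)
From mathcomp Require Import all_boot all_order all_algebra.
From mathcomp Require Import classical_sets cardinality.
From mathcomp Require Import mpoly.

Set Implicit Arguments.
Unset Strict Implicit.
Unset Printing Implicit Defensive.

Import GRing.Theory.
Local Open Scope classical_set_scope.
Local Open Scope ring_scope.

(* [span G] is the substructure generated by [G]; minimality is with respect
   to inclusion. *)
Definition minimal_generating_set (T : Type) (span : set T -> set T)
    (X G : set T) : Prop :=
  span G = X /\ forall H : set T, H `<=` G -> span H = X -> H = G.

Definition is_submonoid (S : set nat) : Prop :=
  S 0%N /\ forall x y, S x -> S y -> S (x + y)%N.

Definition submonoid_gen (A : set nat) : set nat := smallest is_submonoid A.

Definition numerical_semigroup (S : set nat) : Prop :=
  is_submonoid S /\ finite_set (~` S).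

(* The image of [a] is the minimal generating set; being minimal, it does not
   contain 0. The order in which the generators are listed is arbitrary. *)
Definition minimal_generators (S : set nat) (n : nat) (a : 'I_n -> nat) : Prop :=
  injective a /\ minimal_generating_set submonoid_gen S (range a).

Section Ideals.
Variables (K : fieldType) (n : nat).
Implicit Types (I G M : set {mpoly K[n]}) (p f : {mpoly K[n]}).
Implicit Types (u v w : 'X_{1..n}) (le : rel 'X_{1..n}).

Definition is_ideal I : Prop :=
  [/\ I 0, (forall p f, I p -> I f -> I (p + f))
    & forall p f, I f -> I (p * f)].

Definition ideal_gen G : set {mpoly K[n]} := smallest is_ideal G.

Definition is_binomial p : Prop :=
  exists u v, u != v /\ p = 'X_[u] - 'X_[v].

Definition markov_basis I M : Prop :=
  minimal_generating_set ideal_gen I M /\ forall p, M p -> is_binomial p.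

Definition universal_markov_basis I : set {mpoly K[n]} :=
  \bigcup_(M in [set M | markov_basis I M]) M.

(* [le u v] reads x^u <= x^v; monomials are multiplied by adding their
   exponent vectors. *)
Definition monomial_order le : Prop :=
  [/\ reflexive le, antisymmetric le, transitive le & total le] /\
  (forall u, le 0%MM u) /\
  (forall u v w, le u v -> le (u + w)%MM (v + w)%MM).

Definition is_leading_monomial le f u : Prop :=
  u \in msupp f /\ forall v, v \in msupp f -> le v u.

(* The zero polynomial has no leading monomial, so it contributes nothing. *)
Definition initial_ideal le G : set {mpoly K[n]} :=
  ideal_gen [set p | exists f u,
    [/\ G f, is_leading_monomial le f u & p = 'X_[u]]].

Definition groebner_basis le I G : Prop :=
  [/\ finite_set G, G `<=` I & initial_ideal le G = initial_ideal le I].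

Definition reduced_groebner_basis le I G : Prop :=
  [/\ groebner_basis le I G,
      (forall f, G f -> exists u, is_leading_monomial le f u /\ f@_u = 1)
    & forall f w, G f -> w \in msupp f ->
        ~ initial_ideal le (G `\ f) 'X_[w]].

Definition universal_groebner_basis I : set {mpoly K[n]} :=
  \bigcup_(le in [set le | monomial_order le])
    \bigcup_(G in [set G | reduced_groebner_basis le I G]) G.

Definition sign_closure G : set {mpoly K[n]} := [set p | G p \/ G (- p)].

(* Binomials are identified up to sign: the elements of reduced Groebner bases
   are monic, whereas Markov bases may contain either sign of a binomial. *)
Definition generalized_robust I : Prop :=
  sign_closure (universal_groebner_basis I) =
  sign_closure (universal_markov_basis I).

End Ideals.

Section Toric.
Variables (K : fieldType) (n : nat) (a : 'I_n -> nat).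

Definition degA (u : 'X_{1..n}) : nat := (\sum_(i < n) u i * a i)%N.

Definition binomial_of_degree (d : nat) (p : {mpoly K[n]}) : Prop :=
  exists u v : 'X_{1..n},
    [/\ u != v, p = 'X_[u] - 'X_[v], degA u = d & degA v = d].

Definition toric_ideal : set {mpoly K[n]} :=
  ideal_gen [set p | exists d, binomial_of_degree d p].

Definition unique_betti_element : Prop :=
  exists M : set {mpoly K[n]}, markov_basis toric_ideal M /\
    exists d : nat, forall p, M p -> binomial_of_degree d p.

End Toric.

Arguments toric_ideal K {n} a.
Arguments unique_betti_element K {n} a.

(* Main.v *)
Require Import Defs.
From mathcomp Require Import all_boot all_order all_algebra.
From mathcomp Require Import boolp classical_sets cardinality.
From mathcomp Require Import mpoly.
From mathcomp Require Import zify.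

(** Both properties are equivalent to a third, arithmetic one: the least common
multiples of the pairs of distinct generators are all equal to a single number
[b] (lemmas [robust_lcm], [lcm_robust], [unique_betti_lcm] and
[lcm_unique_betti]).

Write [lower_ideal d] for the ideal generated by the binomials of the toric
ideal of degree less than [d].  Two facts turn questions on universal bases
into questions on single binomials of degree [d].

- A binomial belongs to some Markov basis exactly when it is not in
  [lower_ideal d] ([markov_not_lower], [not_lower_markov]).  Two monomials of
  one degree that share a variable differ by an element of [lower_ideal d], so
  a path of such monomials from [u] to [v] excludes [x^u - x^v] from all Markov
  bases.
- For a monomial order, call a monomial standard if it is the least one of its
  degree.  The reduced Groebner basis consists of the [x^u - x^v] where [u] and
  [v] have the same degree, [v] is standard, and [u] is a corner: not standard
  itself, while all its proper divisors are
  ([reduced_groebner_corner], [corner_universal]).  In particular the circuits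
  [x_i^(l/a_i) - x_j^(l/a_j)], where [l] is the least common multiple of [a_i]
  and [a_j], are in the universal Groebner basis ([circuit_universal]).

Suppose that the ideal is generalized robust.  Then no circuit is in the ideal
of lower degree.  Let [b = lcm(a_i, a_j)] be the smallest of these degrees and
let [k] be a third index such that [lcm(a_i, a_k)] and [lcm(a_j, a_k)] both
exceed [b].  If they were different, a path would join the two monomials of a
circuit ([lcma_le_of_lt]).  If both are [l], then [b] divides [l], hence
[2 b <= l]; replacing [x_i^(b/a_i)] by [x_j^(b/a_j)] in [x_i^(l/a_i)] gives a
monomial [u] such that [x^u - x_k^(l/a_k)] is in a Markov basis.  It is in no
reduced Groebner basis, since [u] is a proper multiple of both [x_i^(b/a_i)]
and [x_j^(b/a_j)], one of which is not standard ([robust_no_gluing]).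

Suppose that all Markov elements have degree [b].  The circuit of [i] and [j]
has to be linked by moves of degree [b], and a move that applies to a power of
[x_i] starts from a power of [x_i]; so [a_i] divides [b], and [b] is at most the
degree of the circuit.

Suppose finally that all the least common multiples are [b], and let
[c_i = b / a_i].  These numbers are pairwise coprime, and [c_i] divides every
generator except [a_i], to which it is coprime because the generators have no
common divisor.  So two monomials of the same degree have exponents congruent
modulo [c_i] at [x_i], and distinct such monomials are multiples of
[x_i^(c_i)] and of [x_j^(c_j)] for some distinct [i] and [j]
([fiber_powers]).  It follows that the [x_i^(c_i) - x_j^(c_j)], all of
degree [b], generate the toric ideal and make up both universal bases. *)

Local Open Scope classical_set_scope.

Section ToricIdeals.
Set Implicit Arguments.
Unset Strict Implicit.
Unset Printing Implicit Defensive.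
Import GRing.Theory.
Local Open Scope ring_scope.

(** * Ideals, coefficient sums and binomials *)

Section Ideals.

Variables (K : fieldType) (n : nat).
Implicit Types (f g h p q : {mpoly K[n]}) (G H I J M : set {mpoly K[n]}).
Implicit Types (u v w z s t : 'X_{1..n}) (P : pred 'X_{1..n}).

Lemma ideal_gen_is_ideal G : is_ideal (ideal_gen G).
Proof.
split=> [J [[J0 _ _] _] // | p f Ip If J JP | p f If J JP];
  have [[_ JD JM] _] := JP.
  by apply: JD; [apply: Ip | apply: If].
by apply: JM; apply: If.
Qed.

Lemma ideal_genS G J : is_ideal J -> G `<=` J -> ideal_gen G `<=` J.
Proof. exact: smallest_sub. Qed.

Lemma ideal_gen_mono G H : G `<=` H -> ideal_gen G `<=` ideal_gen H.
Proof.
move=> sGH; apply: ideal_genS; first exact: ideal_gen_is_ideal.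
exact: sub_smallest.
Qed.

Lemma ideal_gen_sub G : G `<=` ideal_gen G.
Proof. exact: sub_gen_smallest. Qed.

Lemma idealN J f : is_ideal J -> J f -> J (- f).
Proof. by case=> _ _ JM Jf; rewrite -mulN1r; apply: JM. Qed.

Lemma idealB J f g : is_ideal J -> J f -> J g -> J (f - g).
Proof. by move=> JI Jf Jg; case: (JI) => _ JD _; apply: JD; last exact: idealN. Qed.

(** Differences of monomials chain like a path: this is how connectedness of
    fibers is expressed inside an ideal. *)
Lemma ideal_trans J v u w : is_ideal J ->
  J ('X_[u] - 'X_[v]) -> J ('X_[v] - 'X_[w]) -> J ('X_[u] - 'X_[w]).
Proof.
case=> _ JD _ Juv Jvw; have -> : 'X_[u] - 'X_[w] =
  ('X_[u] - 'X_[v]) + ('X_[v] - 'X_[w]) :> {mpoly K[n]} by rewrite addrA subrK.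
exact: JD.
Qed.

Lemma ideal_sym J u v : is_ideal J ->
  J ('X_[u] - 'X_[v]) -> J ('X_[v] - 'X_[u]).
Proof. by move=> JI Juv; rewrite -opprB; apply: idealN. Qed.

Lemma ideal_refl J u : is_ideal J -> J ('X_[u] - 'X_[u]).
Proof. by case=> J0 _ _; rewrite subrr. Qed.

Lemma ideal_shift J w u v : is_ideal J ->
  J ('X_[u] - 'X_[v]) -> J ('X_[u + w] - 'X_[v + w]).
Proof. by case=> _ _ JM Juv; rewrite !mpolyXD -mulrBl mulrC; apply: JM. Qed.

Definition coef_sum P f := \sum_(z <- msupp f | P z) f@_z.

(** Over a list of monomials independent of the polynomial, the sum of
    coefficients is visibly linear. *)
Lemma coef_sumE (r : seq 'X_{1..n}) P f : uniq r -> {subset msupp f <= r} ->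
  coef_sum P f = \sum_(z <- r | P z) f@_z.
Proof.
move=> Ur sfr; rewrite (bigID (mem (msupp f))) /= [X in _ + X]big1 ?addr0; last first.
  by move=> z /andP[_ zf]; apply/eqP; rewrite mcoeff_eq0.
rewrite /coef_sum; under [RHS]eq_bigl do rewrite andbC.
rewrite -[RHS]big_filter_cond; apply: perm_big; apply: uniq_perm.
- exact: msupp_uniq.
- exact: filter_uniq.
move=> z; rewrite mem_filter andbC.
by case: (boolP (z \in msupp f)) => [/sfr ->|]; rewrite ?andbF.
Qed.

Lemma coef_sum0 P : coef_sum P 0 = 0.
Proof. by rewrite /coef_sum msupp0 big_nil. Qed.

Lemma coef_sumD P f g : coef_sum P (f + g) = coef_sum P f + coef_sum P g.
Proof.
pose r := undup (msupp f ++ msupp g).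
have Ur : uniq r by exact: undup_uniq.
rewrite !(@coef_sumE r) //.
- by rewrite -big_split; apply: eq_bigr => z _; rewrite mcoeffD.
- by move=> z; rewrite mem_undup mem_cat => ->; rewrite orbT.
- by move=> z; rewrite mem_undup mem_cat => ->.
by move=> z /msuppD_le; rewrite mem_undup.
Qed.

Lemma coef_sumZ P c f : coef_sum P (c *: f) = c * coef_sum P f.
Proof.
rewrite (@coef_sumE (msupp f)) ?msupp_uniq //; last exact: msuppZ_le.
by rewrite mulr_sumr; apply: eq_bigr => z _; rewrite mcoeffZ.
Qed.

Lemma coef_sumN P f : coef_sum P (- f) = - coef_sum P f.
Proof. by rewrite -scaleN1r coef_sumZ mulN1r. Qed.

Lemma coef_sumX P u : coef_sum P 'X_[u] = (P u)%:R.
Proof.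
by rewrite /coef_sum msuppX big_cons big_nil mcoeffX eqxx addr0; case: (P u).
Qed.

Lemma coef_sumMX P w f :
  coef_sum P (f * 'X_[w]) = coef_sum (fun z => P (z + w)%MM) f.
Proof.
rewrite /coef_sum (perm_big _ (msuppMX f w)) big_map.
by apply: eq_big => z; rewrite ?mcoeffMX // addmC.
Qed.

Lemma coef_sumM P p f : (forall w, coef_sum (fun z => P (z + w)%MM) f = 0) ->
  coef_sum P (p * f) = 0.
Proof.
move=> f0; rewrite [p in p * f]mpolyE mulr_suml.
elim: (msupp p) => [|w r IHr]; first by rewrite big_nil coef_sum0.
rewrite big_cons coef_sumD IHr addr0 -scalerAl coef_sumZ.
by rewrite [X in coef_sum _ X]mulrC coef_sumMX f0 mulr0.
Qed.

(** The elements on which a family of coefficient sums vanishes form an ideal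
    as soon as the family is stable under translation, since multiplying a
    polynomial by a monomial translates its support. *)
Lemma coef_sum_ideal_gen (Q : pred 'X_{1..n} -> Prop) G :
  (forall P w, Q P -> Q (fun z => P (z + w)%MM)) ->
  (forall P g, Q P -> G g -> coef_sum P g = 0) ->
  forall P f, Q P -> ideal_gen G f -> coef_sum P f = 0.
Proof.
move=> QD QG P f QP Gf.
have JI : is_ideal [set h | forall P, Q P -> coef_sum P h = 0].
  split=> [P' _ | h h' Jh Jh' P' QP' | h h' Jh' P' QP']; first exact: coef_sum0.
    by rewrite coef_sumD Jh // Jh' // addr0.
  by apply: coef_sumM => w; apply: Jh'; apply: QD.
exact: (ideal_genS JI (fun g Gg P' QP' => QG P' g QP' Gg) Gf).
Qed.

(** The set of monomials [P] is a union of classes for the congruence spanned by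
    the binomials of [G]: a move replaces x^(s+w) by x^(t+w). *)
Definition invariant_under G P := forall q, G q -> exists s t,
  q = 'X_[s] - 'X_[t] /\ forall w, P (s + w)%MM = P (t + w)%MM.

(** Summing the coefficients over a union of classes is a linear form that
    vanishes on the multiples of the generators, hence on the ideal.  This is
    how non-membership is proved throughout. *)
Lemma invariant_coef_sum G P f : invariant_under G P -> ideal_gen G f ->
  coef_sum P f = 0.
Proof.
apply: coef_sum_ideal_gen => {f} [{}P w invP q /invP[s [t [-> st]]]
  | {}P q invP /invP[s [t [-> st]]]].
  by exists s, t; split=> // w'; rewrite -!addmA.
rewrite coef_sumD coef_sumN !coef_sumX.
by have := st 0%MM; rewrite !addm0 => ->; rewrite subrr.
Qed.

Lemma invariant_binomial G P u v : invariant_under G P ->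
  ideal_gen G ('X_[u] - 'X_[v]) -> P u = P v.
Proof.
move=> invP /(invariant_coef_sum invP)/eqP; rewrite coef_sumD coef_sumN !coef_sumX subr_eq0.
by case: (P u) (P v) => [] [] //; rewrite ?oner_eq0 // eq_sym oner_eq0.
Qed.

Lemma msupp_binomial u v w : w \in msupp ('X_[u] - 'X_[v] : {mpoly K[n]}) ->
  w = u \/ w = v.
Proof.
rewrite mcoeff_msupp mcoeffB !mcoeffX.
case: (eqVneq u w) => [->|_]; first by left.
by case: (eqVneq v w) => [->|_]; [right | rewrite subrr eqxx].
Qed.

Lemma mcoeff_binomial_l u v : u != v -> ('X_[u] - 'X_[v] : {mpoly K[n]})@_u = 1.
Proof. by move=> uv; rewrite mcoeffB !mcoeffX eqxx eq_sym (negPf uv) subr0. Qed.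

Lemma mcoeff_binomial_r u v : u != v -> ('X_[u] - 'X_[v] : {mpoly K[n]})@_v = -1.
Proof. by move=> uv; rewrite mcoeffB !mcoeffX eqxx (negPf uv) sub0r. Qed.

Lemma eq_binomial u v s t : u != v ->
  'X_[u] - 'X_[v] = 'X_[s] - 'X_[t] :> {mpoly K[n]} ->
  (u = s /\ v = t) \/ (u = t /\ v = s).
Proof.
move=> uv E.
have U : u = s \/ u = t.
  by apply: msupp_binomial; rewrite -E mcoeff_msupp mcoeff_binomial_l // oner_eq0.
have V : v = s \/ v = t.
  by apply: msupp_binomial; rewrite -E mcoeff_msupp mcoeff_binomial_r // oppr_eq0 oner_eq0.
case: U V => [] eu [] ev; auto; by rewrite eu ev eqxx in uv.
Qed.

(** The polynomials whose support consists of multiples of the generators form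
    an ideal. *)
Lemma monomial_ideal G w :
  (forall p, G p -> exists u, p = 'X_[u]) -> ideal_gen G 'X_[w] ->
  exists u z, G 'X_[u] /\ w = (u + z)%MM.
Proof.
move=> Gmon Gw.
pose J : set {mpoly K[n]} := [set f | forall w, w \in msupp f ->
  exists u z, G 'X_[u] /\ w = (u + z)%MM].
suff JI : is_ideal J.
  apply: (ideal_genS JI _ Gw); last by rewrite msuppX inE.
  move=> p Gp; have [u up] := Gmon p Gp; rewrite up in Gp *.
  by move=> z; rewrite msuppX inE => /eqP->; exists u, 0%MM; rewrite addm0.
split=> [z | p f Jp Jf z /msuppD_le | p f Jf z /msuppM_le]; first by rewrite msupp0.
  by rewrite mem_cat => /orP[/Jp | /Jf].
case/allpairsP => -[z1 z2] /= [_ /Jf[u [z' [Gu ->]]] ->].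
by exists u, (z1 + z')%MM; rewrite addmA (addmC z1) -addmA.
Qed.

(** A finite generating set contains a minimal one: take one with the fewest
    elements. *)
Lemma finite_markov_basis I B : finite_set B -> (forall p, B p -> is_binomial p) ->
  ideal_gen B = I -> exists M, markov_basis I M /\ M `<=` B.
Proof.
move=> /finite_seqP[r rB] Bbin BI.
pose gen (k : nat) : bool := `[< exists s : seq {mpoly K[n]},
  [/\ size s = k, {subset s <= r} & ideal_gen [set` s] = I] >].
have exg : exists k, gen k.
  by exists (size r); apply/asboolP; exists r; split=> //; rewrite -rB.
have [k /asboolP kg kmin] := ex_minnP exg.
case: kg => s [sk sr sI].
have sB : [set` s] `<=` B by rewrite rB => p /sr.
exists [set` s]; split=> //; split; last by move=> p /sB /Bbin.
split=> // H Hs HI; apply/seteqP; split=> // p ps.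
apply: contrapT => nHp.
pose s' := [seq q <- s | `[<H q>]].
have s'H : [set` s'] = H.
  apply/seteqP; split=> q /=; rewrite mem_filter; first by case/andP=> /asboolP.
  by move=> Hq; apply/andP; split; [apply/asboolP | apply: Hs].
have /kmin : gen (size s').
  apply/asboolP; exists s'; split; rewrite ?s'H // => q.
  by rewrite mem_filter => /andP[_ /sr].
apply/negP; rewrite -ltnNge -sk size_filter.
rewrite -(count_predC (fun q => `[<H q>])) -[X in (X < _)%N]addn0 ltn_add2l -has_count.
by apply/hasP; exists p => //=; apply/asboolPn.
Qed.

End Ideals.

(** * Toric ideals and Markov bases *)

Section Toric.

Variables (K : fieldType) (n : nat) (a : 'I_n -> nat).
Hypothesis a_gt0 : forall i, (0 < a i)%N.
Implicit Types (f g h p q : {mpoly K[n]}) (G H I J M : set {mpoly K[n]}).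
Implicit Types (u v w z s t : 'X_{1..n}) (P : pred 'X_{1..n}) (i j k : 'I_n).

Local Notation deg := (degA a).
Local Notation toric := (toric_ideal K a).

Lemma degAD u v : deg (u + v)%MM = (deg u + deg v)%N.
Proof. by rewrite -big_split; apply: eq_bigr => i _; rewrite mnmDE mulnDl. Qed.

Lemma degAU i c : deg (U_(i) *+ c)%MM = (c * a i)%N.
Proof.
rewrite /degA (bigD1 i) //= big1 => [|j ji]; rewrite mulmnE mnm1E.
  by rewrite eqxx mul1n addn0.
by rewrite eq_sym (negPf ji).
Qed.

Lemma mdeg_degA u : (mdeg u <= deg u)%N.
Proof. by rewrite mdegE; apply: leq_sum => i _; rewrite leq_pmulr. Qed.

Lemma degA_gt0 u : u != 0%MM -> (0 < deg u)%N.
Proof. by rewrite -mdeg_eq0 -lt0n => /leq_trans-> //; apply: mdeg_degA. Qed.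

Lemma mnm_splitU u i c : (c <= u i)%N -> exists w, u = (w + U_(i) *+ c)%MM.
Proof.
move=> cu; exists (u - U_(i) *+ c)%MM; rewrite submK //.
apply/mnm_lepP => j; rewrite mulmnE mnm1E.
by case: eqP => [<-|_]; rewrite ?mul1n ?mul0n.
Qed.

Lemma mulmU_eq0 i c : ((U_(i) *+ c)%MM == 0%MM :> 'X_{1..n}) = (c == 0)%N.
Proof. by rewrite -mdeg_eq0 mdegMn mdeg1 mul1n. Qed.

Definition monomials_upto D : seq 'X_{1..n} :=
  [seq (z : 'X_{1..n}) | z : 'X_{1..n < D.+1}].

Lemma mem_monomials_upto D u : (deg u <= D)%N -> u \in monomials_upto D.
Proof.
move=> uD; have uD' : (mdeg u < D.+1)%N by rewrite ltnS (leq_trans (mdeg_degA u)).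
by apply/mapP; exists (BMultinom uD'); rewrite ?mem_enum.
Qed.

Lemma toric_is_ideal : is_ideal toric.
Proof. exact: ideal_gen_is_ideal. Qed.

Lemma toric_binomial u v : deg u = deg v -> toric ('X_[u] - 'X_[v]).
Proof.
move=> uv; have [->|neq_uv] := eqVneq u v; first exact: (ideal_refl _ toric_is_ideal).
by apply: ideal_gen_sub; exists (deg v), u, v.
Qed.

Lemma deg_invariant d : invariant_under
  [set p : {mpoly K[n]} | exists d, binomial_of_degree a d p] (fun z => deg z == d).
Proof.
move=> _ [e [s [t [_ -> se te]]]]; exists s, t; split=> // w.
by rewrite !degAD se te.
Qed.

(** Each fiber of the degree is a union of classes of monomials. *)
Lemma toric_coef_sum d f : toric f -> coef_sum (fun z => deg z == d) f = 0.
Proof. by apply: invariant_coef_sum; apply: deg_invariant. Qed.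

Lemma toric_deg u v : toric ('X_[u] - 'X_[v]) -> deg u = deg v.
Proof.
by move=> /(invariant_binomial (deg_invariant (deg v))) /=; rewrite eqxx => /eqP.
Qed.

Lemma toric_genS J : is_ideal J ->
  (forall u v, deg u = deg v -> J ('X_[u] - 'X_[v])) -> toric `<=` J.
Proof.
move=> JI Juv; apply: ideal_genS => // _ [d [u [v [_ -> <- vu]]]].
by apply: Juv.
Qed.

Definition lower_ideal d : set {mpoly K[n]} :=
  ideal_gen [set p | exists e, (e < d)%N /\ binomial_of_degree a e p].

Lemma lower_ideal_is_ideal d : is_ideal (lower_ideal d).
Proof. exact: ideal_gen_is_ideal. Qed.

Lemma lower_ideal_lt d u v : deg u = deg v -> (deg u < d)%N ->
  lower_ideal d ('X_[u] - 'X_[v]).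
Proof.
move=> uv ud; have [->|neq_uv] := eqVneq u v.
  exact: (ideal_refl _ (lower_ideal_is_ideal d)).
by apply: ideal_gen_sub; exists (deg v); split; [rewrite -uv | exists u, v].
Qed.

Lemma lower_idealS d J : is_ideal J ->
  (forall u v, deg u = deg v -> (deg u < d)%N -> J ('X_[u] - 'X_[v])) ->
  lower_ideal d `<=` J.
Proof.
move=> JI Juv; apply: ideal_genS => // _ [e [ed [u [v [_ -> ue ve]]]]].
by apply: Juv; rewrite ue.
Qed.

Lemma lower_ideal_shift d w u v : w != 0%MM -> deg u = deg v -> deg (u + w)%MM = d ->
  lower_ideal d ('X_[u + w] - 'X_[v + w]).
Proof.
move=> w0 uv uwd; apply: (ideal_shift _ (lower_ideal_is_ideal d)).
apply: lower_ideal_lt => //.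
by rewrite -uwd degAD -[X in (X < _)%N]addn0 ltn_add2l degA_gt0.
Qed.

(** Dividing by the common variable leaves a binomial of lower degree. *)
Lemma lower_ideal_share i d u v : (0 < u i)%N -> (0 < v i)%N ->
  deg u = d -> deg v = d -> lower_ideal d ('X_[u] - 'X_[v]).
Proof.
move=> /mnm_splitU[u' ->] /mnm_splitU[v' ->]; rewrite !degAD => ud vd.
apply: lower_ideal_shift; rewrite ?mulmU_eq0 ?degAD //.
by apply/eqP; rewrite -(eqn_add2r (deg (U_(i) *+ 1)%MM)) ud vd.
Qed.

(** A binomial of lower degree is linked by moves that take place in lower
    degree, where an element of degree [d] cannot act: the ideal of lower
    degree is generated without that element, so if it contained it, the
    element would be redundant in the Markov basis. *)
Lemma markov_not_lower M u v : u != v -> markov_basis toric M ->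
  M ('X_[u] - 'X_[v]) -> ~ lower_ideal (deg u) ('X_[u] - 'X_[v]).
Proof.
move=> neq_uv [[MI Mmin] Mbin] Mp; set p := _ - _ in Mp *; move=> plow.
have JI : is_ideal (ideal_gen (M `\ p)) by exact: ideal_gen_is_ideal.
have Mtoric q : M q -> toric q by rewrite -MI; apply: ideal_gen_sub.
have uv : deg u = deg v by apply: toric_deg; apply: Mtoric.
suff Jp : ideal_gen (M `\ p) p.
  have /(Mmin _ (@subDsetl _ _ _)) E : ideal_gen (M `\ p) = toric.
    apply/seteqP; split; first by rewrite -MI; apply: ideal_gen_mono; exact: subDsetl.
    rewrite -MI; apply: ideal_genS => // q Mq; have [-> //|qp] := eqVneq q p.
    by apply: ideal_gen_sub; split=> //; apply/eqP.
  by have := Mp; rewrite -{1}E => -[_ []].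
move: plow; apply: lower_idealS => // s t st su.
(* The moves of [p] act in degrees at least [deg u], above that of [t], so the
   set of monomials equivalent to [t] without using [p] is invariant under all
   of [M]. *)
pose P z := `[< deg z = deg t /\ ideal_gen (M `\ p) ('X_[z] - 'X_[t]) >].
have invP : invariant_under M P.
  move=> q Mq; have [s' [t' [neq_st' qE]]] := Mbin q Mq.
  have st' : deg s' = deg t' by apply: toric_deg; rewrite -qE; apply: Mtoric.
  exists s', t'; split=> // w; have [qp|qp] := eqVneq q p.
    have us' : deg s' = deg u.
      by have [[-> _]|[-> _]] := eq_binomial neq_uv (etrans (esym qp) qE).
    suff Pfalse z : deg z = deg u -> P (z + w)%MM = false by rewrite !Pfalse -?st'.
    by move=> zu; apply/asboolPn => -[]; rewrite degAD zu; lia.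
  have Jst : ideal_gen (M `\ p) ('X_[s' + w] - 'X_[t' + w]).
    by apply: (ideal_shift _ JI); rewrite -qE; apply: ideal_gen_sub; split=> //; apply/eqP.
  apply/asboolP/asboolP => -[]; rewrite !degAD -?st' => zt Jz; split=> //.
    exact: (ideal_trans JI (ideal_sym JI Jst) Jz).
  exact: (ideal_trans JI Jst Jz).
suff /asboolP[] : P s by [].
rewrite (@invariant_binomial _ _ M P s t invP).
  by apply/asboolP; split=> //; apply: (ideal_refl _ JI).
by rewrite MI; apply: toric_binomial.
Qed.

Definition gens_sum := (\sum_i a i)%N.
(** Above this degree, any monomial has a variable with an exponent larger than
    every generator. *)
Definition degree_bound := (gens_sum * gens_sum)%N.

Lemma le_gens_sum i : (a i <= gens_sum)%N.
Proof. by rewrite /gens_sum (bigD1 i) //= leq_addr. Qed.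

Lemma large_coord u : (degree_bound < deg u)%N -> exists i, (gens_sum < u i)%N.
Proof.
move=> ub; apply: contrapT => nlarge; move: ub; rewrite ltnNge => /negP; apply.
rewrite /degree_bound {2}/gens_sum big_distrr /=; apply: leq_sum => i _.
rewrite leq_mul2r; apply/orP; right; rewrite leqNgt; apply/negP => ui.
by apply: nlarge; exists i.
Qed.

(** In large degree, [u] and [v] have large exponents at some variables [x_i]
    and [x_j]; replacing [x_i^(a_j)] by [x_j^(a_i)] in [u] gives a monomial
    that shares a variable with both.  Hence the toric ideal is generated in
    bounded degree, which makes finite sets of binomials sufficient. *)
Lemma lower_ideal_large u v : deg u = deg v -> (degree_bound < deg u)%N ->
  lower_ideal (deg u) ('X_[u] - 'X_[v]).
Proof.
move=> uv ub; have [i ui] := large_coord ub; rewrite uv in ub.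
have [j vj] := large_coord ub.
have [ij|ij] := eqVneq i j.
  by subst j; apply: (lower_ideal_share (i := i)); lia.
have aj := le_gens_sum j; have [w uE] := @mnm_splitU u i (a j) ltac:(lia).
pose u' := (w + U_(j) *+ a i)%MM.
have u'u : deg u' = deg u by rewrite uE /u' !degAD !degAU mulnC.
apply: (ideal_trans (v := u') (lower_ideal_is_ideal (deg u))).
  apply: (lower_ideal_share (i := i)) => //; first lia.
  move: ui; rewrite uE /u' !mnmDE !mulmnE !mnm1E eqxx eq_sym (negPf ij); lia.
apply: (lower_ideal_share (i := j)); rewrite ?u'u //; last lia.
rewrite /u' !mnmDE !mulmnE !mnm1E eqxx; have := a_gt0 i; lia.
Qed.

Lemma finite_binomials D (B : set {mpoly K[n]}) :
  (forall p, B p -> exists s t,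
     [/\ p = 'X_[s] - 'X_[t], (deg s <= D)%N & (deg t <= D)%N]) ->
  finite_set B.
Proof.
pose r := [seq 'X_[s] - 'X_[t] : {mpoly K[n]} |
  s <- monomials_upto D, t <- monomials_upto D].
move=> BD; apply: (@sub_finite_set _ _ [set` r]).
  move=> p /BD[s [t [-> sD tD]]]; apply/allpairsP; exists (s, t).
  by split=> //; apply: mem_monomials_upto.
exact: finite_seq.
Qed.

(** The fiber is cut into the class [C] of [u] modulo the ideal of lower degree
    and its complement, which contains [v].  Among the binomials of bounded
    degree, discard those across the cut, except the given one.  What remains
    still generates, and any minimal generating subset must keep the only
    bridge across the cut. *)
Lemma not_lower_markov u v : deg u = deg v -> ~ lower_ideal (deg u) ('X_[u] - 'X_[v]) ->
  exists M, markov_basis toric M /\ M ('X_[u] - 'X_[v]).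
Proof.
move=> uv nlow; set p := 'X_[u] - 'X_[v]; set d := deg u in nlow.
have lowI := lower_ideal_is_ideal d.
have neq_uv : u != v.
  by apply/eqP => E; apply: nlow; rewrite E; apply: (ideal_refl _ lowI).
pose C z := deg z = d /\ lower_ideal d ('X_[z] - 'X_[u]).
have Cu : C u by split=> //; apply: (ideal_refl _ lowI).
have nCv : ~ C v by case=> _ /(ideal_sym lowI).
pose D := maxn degree_bound d.
pose B : set {mpoly K[n]} := [set q | exists s t, [/\ s != t, q = 'X_[s] - 'X_[t],
  deg s = deg t, (deg s <= D)%N & q = p \/ (C s <-> C t)]].
have BI : is_ideal (ideal_gen B) by exact: ideal_gen_is_ideal.
have Bp : B p by exists u, v; split=> //; [rewrite /D /d leq_maxr | left].
have genB : ideal_gen B = toric.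
  apply/seteqP; split.
    apply: ideal_genS => [|_ [s [t [_ -> st _ _]]]]; first exact: toric_is_ideal.
    exact: toric_binomial.
  apply: toric_genS => // s; move: {2}(deg s) (leqnn (deg s)) => e.
  elim/ltn_ind: e s => e IHe s se t st.
  have lowB d' : (d' <= deg s)%N -> lower_ideal d' `<=` ideal_gen B.
    move=> d's; apply: lower_idealS => // s' t' st' s'd'; apply: (IHe (deg s')) => //.
    by apply: leq_trans s'd' (leq_trans d's se).
  have [sD|sD] := leqP (deg s) D; last first.
    apply: (lowB (deg s)) => //; apply: lower_ideal_large => //.
    by move: sD; rewrite /D; lia.
  have CB s' t' : deg s' = deg t' -> (deg s' <= D)%N -> (C s' <-> C t') ->
      ideal_gen B ('X_[s'] - 'X_[t']).
    move=> st' s'D Cst'; have [->|neq_st'] := eqVneq s' t'.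
      exact: (ideal_refl _ BI).
    by apply: ideal_gen_sub; exists s', t'; split=> //; right.
  have key s' t' : deg s' = deg s -> deg t' = deg s -> C s' -> ~ C t' ->
      ideal_gen B ('X_[s'] - 'X_[t']).
    move=> s's t's [s'd Cs'] nCt'; have ds : d = deg s by rewrite -s'd.
    apply: (ideal_trans (v := u) BI); first by apply: lowB Cs'; rewrite ds.
    apply: (ideal_trans (v := v) BI); first exact: ideal_gen_sub.
    by apply: CB; rewrite -?uv -/d ?ds ?t's.
  (* A binomial across the cut is the sum of the bridge and of two binomials on
   either side of it. *)
case: (pselect (C s)) (pselect (C t)) => Cs [] Ct; try exact: CB.
    exact: key.
  by apply: (ideal_sym BI); apply: key.
have finB : finite_set B.
  apply: (@finite_binomials D) => _ [s [t [_ -> st sD _]]].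
  by exists s, t; split=> //; rewrite -st.
have binB q : B q -> is_binomial q by move=> [s [t [neq_st -> _ _ _]]]; exists s, t.
have [M [MM MB]] := finite_markov_basis finB binB genB.
exists M; split=> //; apply: contrapT => nMp; have [[MI _] _] := MM.
have : ideal_gen (B `\ p) p.
  have : ideal_gen M p by rewrite MI; apply: toric_binomial.
  apply: ideal_gen_mono => q Mq; split; first exact: MB.
  by move=> qp; rewrite qp in Mq.
(* Without the bridge, [C] is invariant under moves: those of lower degree stay
   in the class modulo the ideal of lower degree. *)
pose P z := `[< C z >].
have invP : invariant_under (B `\ p) P.
  move=> q [[s [t [_ qE st _ Cst]]] qp]; exists s, t; split=> // w.
  case: Cst => // Cst; have [->|w0] := eqVneq w 0%MM.
    by rewrite !addm0; apply/asboolP/asboolP => /Cst.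
  have stw : deg (s + w)%MM = d -> lower_ideal d ('X_[s + w] - 'X_[t + w]).
    exact: lower_ideal_shift.
  have swtw : deg (s + w)%MM = deg (t + w)%MM by rewrite !degAD st.
  apply/asboolP/asboolP => -[E Cz]; split; rewrite -?swtw // ?swtw //.
    exact: (ideal_trans lowI (ideal_sym lowI (stw E)) Cz).
  by apply: (ideal_trans lowI _ Cz); apply: stw; rewrite swtw.
move=> /(invariant_binomial invP) Puv; apply: nCv; apply/asboolP.
by rewrite -[`[< _ >]]/(P v) -Puv; apply/asboolP.
Qed.

End Toric.

Arguments lower_ideal K {n} a d _.

(** * Reduced Groebner bases of toric ideals *)

Section Groebner.

Variables (K : fieldType) (n : nat) (a : 'I_n -> nat).
Hypothesis a_gt0 : forall i, (0 < a i)%N.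
Implicit Types (f g h p q : {mpoly K[n]}) (G H I J M : set {mpoly K[n]}).
Implicit Types (u v w z s t : 'X_{1..n}) (P : pred 'X_{1..n}) (i j k : 'I_n).

Local Notation deg := (degA a).
Local Notation toric := (toric_ideal K a).

Section Order.
Variable le : rel 'X_{1..n}.
Hypothesis le_order : monomial_order le.

Lemma mo_refl u : le u u. Proof. by have [[+ _ _ _] _] := le_order. Qed.
Lemma mo_anti u v : le u v -> le v u -> u = v.
Proof. by have [[_ anti _ _] _] := le_order => uv vu; apply: anti; rewrite uv. Qed.
Lemma mo_trans v u w : le u v -> le v w -> le u w.
Proof. by have [[_ _ tr _] _] := le_order; apply: tr. Qed.
Lemma mo_total u v : le u v \/ le v u.
Proof. by have [[_ _ _ tot] _] := le_order; apply/orP. Qed.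
Lemma mo_add w u v : le u v -> le (u + w)%MM (v + w)%MM.
Proof. by have [_ [_ +]] := le_order; apply. Qed.
Lemma mo_addr u w : le u (u + w)%MM.
Proof. by have [_ [le0 _]] := le_order; rewrite addmC -{1}[u]add0m mo_add. Qed.

Lemma addm_eq_self u w : (u + w)%MM = u -> w = 0%MM.
Proof. by rewrite -{2}[u]addm0 => /addmI. Qed.

(** These are the monomials outside the initial ideal of the toric ideal; each
    fiber has exactly one. *)
Definition standard v := forall z, deg z = deg v -> le v z.

(** The minimal generators of the initial ideal of the toric ideal. *)
Definition corner u := ~ standard u /\
  forall z w, u = (z + w)%MM -> w != 0%MM -> standard z.

Lemma standard_div u w : standard (u + w)%MM -> standard u.
Proof.
move=> su z zu; have [//|le_zu] := mo_total u z.
have /(su _) le_uz : deg (z + w)%MM = deg (u + w)%MM by rewrite !degAD zu.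
by have /addIm-> := mo_anti le_uz (mo_add w le_zu); apply: mo_refl.
Qed.

Lemma standard_uniq u v : standard u -> standard v -> deg u = deg v -> u = v.
Proof. by move=> su sv uv; apply: mo_anti; [apply: su | apply: sv]. Qed.

Lemma not_standard u : ~ standard u -> exists v, [/\ deg v = deg u, le v u & v != u].
Proof.
move=> /existsNP[v /not_implyP[vu nle]]; exists v; split=> //.
  by case: (mo_total u v).
by apply/eqP => E; rewrite E in nle; have := mo_refl u.
Qed.

Lemma exists_standard u : exists v, standard v /\ deg v = deg u.
Proof.
have exmin (r : seq 'X_{1..n}) x :
    exists m, m \in x :: r /\ forall y, y \in x :: r -> le m y.
  elim: r x => [|y r IHr] x.
    by exists x; split=> [|y]; rewrite inE // => /eqP->; apply: mo_refl.
  have [m [mr mmin]] := IHr y; have [le_xm|le_mx] := mo_total x m.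
    exists x; split=> [|z]; first by rewrite inE eqxx.
    by rewrite inE => /predU1P[->|/mmin]; [apply: mo_refl | apply: mo_trans].
  exists m; split=> [|z]; first by rewrite inE mr orbT.
  by rewrite inE => /predU1P[->|/mmin].
pose r := [seq z <- monomials_upto n (deg u) | deg z == deg u].
have [m [mr mmin]] := exmin r u; exists m.
have mu : deg m = deg u.
  by move: mr; rewrite inE mem_filter => /predU1P[->|/andP[/eqP]].
split=> // z zm; apply: mmin; rewrite inE mem_filter zm mu eqxx.
by rewrite (mem_monomials_upto a_gt0) ?orbT // zm mu.
Qed.

Lemma corner_below u : ~ standard u -> exists v w, corner v /\ u = (v + w)%MM.
Proof.
move: {2}(mdeg u) (leqnn (mdeg u)) => d; elim: d u => [|d IHd] u ud nsu.
  exists u, 0%MM; rewrite addm0; split=> //; split=> // z w.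
  move=> E; move: ud; rewrite E mdegD leqn0 addn_eq0 => /andP[_].
  by rewrite mdeg_eq0 => /eqP->; rewrite eqxx.
have [cu|/not_andP[//|]] := pselect (corner u).
  by exists u, 0%MM; rewrite addm0.
move=> /existsNP[z /existsNP[w /not_implyP[uE /not_implyP[w0 nsz]]]].
have zd : (mdeg z <= d)%N by move: ud w0; rewrite uE mdegD -mdeg_eq0; lia.
by have [v [w' [cv zE]]] := IHd z zd nsz; exists v, (w' + w)%MM; rewrite uE zE addmA.
Qed.

Lemma lm_uniq f u v : is_leading_monomial le f u -> is_leading_monomial le f v -> u = v.
Proof. by move=> [uf umax] [vf vmax]; apply: mo_anti; [apply: vmax | apply: umax]. Qed.

Lemma lm_binomial u v : u != v -> le v u ->
  is_leading_monomial le ('X_[u] - 'X_[v] : {mpoly K[n]}) u.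
Proof.
move=> uv le_vu; split; first by rewrite mcoeff_msupp mcoeff_binomial_l ?oner_eq0.
by move=> w /msupp_binomial[] ->; rewrite ?mo_refl.
Qed.

Lemma coef_sum_single P f u : u \in msupp f ->
  (forall z, z \in msupp f -> P z -> z = u) -> P u -> coef_sum P f = f@_u.
Proof.
move=> uf only Pu; rewrite /coef_sum (big_rem u) //= Pu big_seq_cond big1 ?addr0 //.
move=> z /andP[zr Pz]; have := zr; rewrite (rem_filter _ (msupp_uniq f)) mem_filter /=.
by case/andP=> /eqP zu zf; case: zu; apply: only.
Qed.

(** If the leading monomial were standard, it would be the only monomial of its
    degree in the support, against the vanishing of coefficient sums. *)
Lemma toric_lm_not_standard f u : toric f -> is_leading_monomial le f u -> ~ standard u.
Proof.
move=> If [uf umax] su; have := toric_coef_sum (deg u) If.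
rewrite (@coef_sum_single _ f u) //.
  by move=> /eqP; rewrite mcoeff_eq0 uf.
by move=> z zf /eqP zu; apply: mo_anti; [apply: umax | apply: su].
Qed.

(** Elements of the support in the same fiber are equal, so each coefficient is
    a coefficient sum over a fiber. *)
Lemma toric_standard_eq0 f : toric f ->
  (forall z, z \in msupp f -> standard z) -> f = 0.
Proof.
move=> If sf; apply/mpolyP => u; rewrite mcoeff0; apply/eqP.
rewrite mcoeff_eq0; apply/negP => uf; have := toric_coef_sum (deg u) If.
rewrite (@coef_sum_single _ f u) //.
  by move=> /eqP; rewrite mcoeff_eq0 uf.
by move=> z zf /eqP zu; apply: standard_uniq => //; apply: sf.
Qed.

Lemma initial_idealP G w : initial_ideal le G 'X_[w] ->
  exists f u z, [/\ G f, is_leading_monomial le f u & w = (u + z)%MM].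
Proof.
move=> /monomial_ideal[_ [f [u [_ _ ->]]]|u [z [[f [u' [Gf fu' E]]] ->]]].
  by exists u.
exists f, u', z; split=> //; suff -> : u = u' by [].
apply/eqP; move/mpolyP/(_ u): E; rewrite !mcoeffX eqxx.
by case: (eqVneq u' u) => // _ /eqP; rewrite oner_eq0.
Qed.

Lemma initial_ideal_lm G f u w : G f -> is_leading_monomial le f u ->
  initial_ideal le G 'X_[u + w].
Proof.
move=> Gf fu; rewrite mpolyXD mulrC.
have [_ _ IM] := ideal_gen_is_ideal [set p | exists f u,
  [/\ G f, is_leading_monomial le f u & p = 'X_[u] :> {mpoly K[n]}]].
by apply: IM; apply: ideal_gen_sub; exists f, u.
Qed.

Lemma not_standard_initial u : ~ standard u -> initial_ideal le toric 'X_[u].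
Proof.
move=> /not_standard[v [vu le_vu neq_vu]]; rewrite -[u]addm0.
apply: (@initial_ideal_lm _ ('X_[u] - 'X_[v])); first exact: toric_binomial.
by apply: lm_binomial; rewrite // eq_sym.
Qed.

(** Reducedness forces the leading monomial [u] to be a corner and the other
    monomials to be standard; so [f] and [x^u - x^v], where [v] is the standard
    monomial of the fiber of [u], differ by an element of the ideal with
    standard support, which is zero. *)
Lemma reduced_groebner_corner G f : reduced_groebner_basis le toric G -> G f ->
  exists u v, [/\ f = 'X_[u] - 'X_[v], deg u = deg v, corner u & standard v].
Proof.
move=> [[_ GI Gin] Gmonic Gred] Gf; have [u [fu fu1]] := Gmonic f Gf.
have nsu : ~ standard u by apply: toric_lm_not_standard fu; apply: GI.
have lmG z : ~ standard z -> exists g x y,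
    [/\ G g, is_leading_monomial le g x & z = (x + y)%MM].
  by move=> nsz; apply: initial_idealP; rewrite Gin; apply: not_standard_initial.
have only_f w z g y : w \in msupp f -> w = (z + y)%MM -> G g ->
    is_leading_monomial le g z -> g = f.
  move=> wf wE Gg gz; apply: contrapT => gf; apply: (Gred f w Gf wf).
  by rewrite wE; apply: (initial_ideal_lm (f := g)).
have cu : corner u.
  split=> // z w uE w0; apply: contrapT => /lmG[g [x [y [Gg gx zE]]]].
  have gf : g = f.
    by apply: (@only_f u x g (y + w)%MM) => //; [case: fu | rewrite addmA -zE].
  rewrite gf in gx; have ux := lm_uniq fu gx.
  move: uE w0; rewrite zE -ux -addmA => /esym/addm_eq_self/eqP.
  by rewrite -!mdeg_eq0 mdegD addn_eq0 => /andP[_ ->].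
have sf w : w \in msupp f -> w != u -> standard w.
  move=> wf wu; apply: contrapT => /lmG[g [x [y [Gg gx wE]]]].
  have gf : g = f by apply: (@only_f w x g y).
  rewrite gf in gx; have ux := lm_uniq fu gx; move/eqP: wu; apply.
  by case: fu => _ umax; apply: mo_anti; [apply: umax | rewrite wE -ux mo_addr].
have [v [sv vu]] := exists_standard u.
have neq_uv : u != v by apply/eqP => E; rewrite E in nsu.
exists u, v; split=> //; apply/eqP; rewrite -subr_eq0; apply/eqP.
apply: toric_standard_eq0.
  by apply: (idealB (toric_is_ideal _ _)); [apply: GI | apply: toric_binomial].
move=> z; have [->|zu] := eqVneq z u.
  by rewrite mcoeff_msupp mcoeffB fu1 mcoeff_binomial_l // subrr eqxx.
rewrite mcoeff_msupp mcoeffB => zf.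
have [zf'|zf'] := boolP (z \in msupp f); first exact: sf.
have : z \in msupp ('X_[u] - 'X_[v] : {mpoly K[n]}).
  rewrite mcoeff_msupp; move: zf; rewrite -mcoeff_eq0 in zf'.
  by rewrite (eqP zf') sub0r oppr_eq0.
by move=> /msupp_binomial[] E; [rewrite E eqxx in zu | rewrite E].
Qed.

(** As in [lower_ideal_large], a corner of large degree and its standard
    monomial have large exponents at some [x_i] and [x_j].  If [i = j], both can
    be divided by [x_i].  Otherwise they are proper multiples of [x_i^(a_j)] and
    [x_j^(a_i)], which have the same degree and are both standard. *)
Lemma corner_bound u v : corner u -> standard v -> deg u = deg v ->
  (deg u <= degree_bound a)%N.
Proof.
move=> [nsu cu] sv uv; rewrite leqNgt; apply/negP => ub.
have [i ui] := large_coord ub; rewrite uv in ub; have [j vj] := large_coord ub.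
have neq_uv : u <> v by move=> E; rewrite E in nsu.
have [ij|ij] := eqVneq i j.
  subst j; have [u' uE] := @mnm_splitU _ u i 1 ltac:(lia).
  have [v' vE] := @mnm_splitU _ v i 1 ltac:(lia).
  apply: neq_uv; rewrite uE vE; congr (_ + _)%MM; apply: standard_uniq.
  - by apply: cu uE _; rewrite mulmU_eq0.
  - by apply: (@standard_div _ (U_(i) *+ 1)%MM); rewrite -vE.
  by apply/eqP; rewrite -(eqn_add2r (deg (U_(i) *+ 1)%MM)) -!degAD -uE -vE uv.
have aj := le_gens_sum a j; have [w uE] := @mnm_splitU _ u i (a j) ltac:(lia).
have ai := le_gens_sum a i; have [w' vE] := @mnm_splitU _ v j (a i) ltac:(lia).
have sj : standard (U_(j) *+ a i)%MM.
  by apply: (@standard_div _ w'); rewrite addmC -vE.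
have si : standard (U_(i) *+ a j)%MM.
  apply: cu (w) _ _; first by rewrite addmC.
  apply/eqP => w0; move: ui; rewrite uE w0 add0m mulmnE mnm1E eqxx; lia.
have := standard_uniq si sj; rewrite !degAU mulnC => /(_ erefl) /mnmP/(_ i).
rewrite !mulmnE !mnm1E eqxx eq_sym (negPf ij); have := a_gt0 j; lia.
Qed.

(** The binomials attached to the corners form a reduced Groebner basis; the
    bound on the degree of corners makes it finite. *)
Lemma corner_universal u v : corner u -> standard v -> deg u = deg v ->
  universal_groebner_basis toric ('X_[u] - 'X_[v]).
Proof.
move=> cu sv uv.
pose G : set {mpoly K[n]} := [set p | exists u v,
  [/\ p = 'X_[u] - 'X_[v], deg u = deg v, corner u & standard v]].
have lmG s t : deg s = deg t -> corner s -> standard t ->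
    is_leading_monomial le ('X_[s] - 'X_[t] : {mpoly K[n]}) s /\ s != t.
  move=> st [nss _] ct; have neq_st : s != t by apply/eqP => E; rewrite E in nss.
  by split=> //; apply: lm_binomial => //; apply: ct.
exists le => //; exists G; last by exists u, v.
split; first split.
- apply: (@finite_binomials _ _ _ a_gt0 (degree_bound a)) => _ [s [t [-> st cs ct]]].
  have sb := corner_bound cs ct st.
  by exists s, t; split; rewrite -?st.
- by move=> _ [s [t [-> st _ _]]]; apply: toric_binomial.
- apply/seteqP; split.
    apply: ideal_gen_mono => _ [f [s [[x [y [fE xy _ _]]] fs ->]]].
    by exists f, s; split=> //; rewrite fE; apply: toric_binomial.
  apply: ideal_genS; first exact: ideal_gen_is_ideal.
  move=> _ [f [s [If fs ->]]]; have := toric_lm_not_standard If fs.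
  move=> /corner_below[x [w [cx ->]]]; have [y [sy yx]] := exists_standard x.
  apply: (initial_ideal_lm (f := 'X_[x] - 'X_[y])); first by exists x, y.
  by have [] := lmG x y (esym yx) cx sy.
- move=> _ [s [t [-> st cs ct]]]; have [lms neq_st] := lmG s t st cs ct.
  by exists s; rewrite mcoeff_binomial_l.
move=> _ w [s [t [-> st cs ct]]] wf /initial_idealP[_ [x [z [[[x' [y [-> xy cx sy]] neq] gx wE]]]]].
have [gx' _] := lmG x' y xy cx sy; have E := lm_uniq gx gx'; subst x'.
have [nsx _] := cx; have [nss cs'] := cs.
case: (msupp_binomial wf) => E; rewrite E in wE; last first.
  by apply: nsx; apply: (@standard_div _ z); rewrite -wE.
have [z0|z0] := eqVneq z 0%MM; last by apply: nsx; apply: cs' wE z0.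
apply: neq; rewrite wE z0 addm0 (@standard_uniq y t) //.
by rewrite -xy -st wE z0 addm0.
Qed.

End Order.
End Groebner.

(** * Circuits *)

Section Circuits.

Variables (n : nat).
Implicit Types (u v w z s t : 'X_{1..n}) (P : pred 'X_{1..n}) (i j k : 'I_n).

Definition refine_order (phi : 'X_{1..n} -> nat) (le : rel 'X_{1..n}) : rel 'X_{1..n} :=
  fun u v => (phi u < phi v)%N || ((phi u == phi v) && le u v).

Lemma refine_monomial_order phi le :
  (forall u v, phi (u + v)%MM = phi u + phi v)%N -> monomial_order le ->
  monomial_order (refine_order phi le).
Proof.
move=> phiD [[refl anti tr tot] [le0 leD]].
have phi0 : phi 0%MM = 0%N by have := phiD 0%MM 0%MM; rewrite addm0; lia.
rewrite /refine_order; split; last split; first split.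
- by move=> u; rewrite eqxx refl orbT.
- move=> u v /andP[/orP[uv|/andP[/eqP E uv]] /orP[vu|/andP[/eqP E' vu]]]; try lia.
  by apply: anti; rewrite uv.
- move=> v u w /orP[uv|/andP[/eqP E uv]] /orP[vw|/andP[/eqP E' vw]].
  + by rewrite (ltn_trans uv).
  + by rewrite -E' uv.
  + by rewrite E vw.
  by rewrite E E' eqxx (tr _ _ _ uv vw) orbT.
- by move=> u v; case: (ltngtP (phi u) (phi v)) => //= _; apply: tot.
- by move=> u; rewrite phi0 le0 andbT orbC -leq_eqVlt.
move=> u v w; rewrite !phiD ltn_add2r eqn_add2r.
by case/orP=> [->//|/andP[-> /leD->]]; rewrite orbT.
Qed.

Lemma deglex_monomial_order : monomial_order (fun u v : 'X_{1..n} => (u <= v)%O).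
Proof.
split; first split.
- exact: Order.POrderTheory.lexx.
- exact: Order.POrderTheory.le_anti.
- exact: Order.POrderTheory.le_trans.
- exact: Order.TotalTheory.le_total.
split; first exact: le0m.
by move=> u v w uv; apply: lem_add.
Qed.

(** In this order, any monomial in [x_i] and [x_j] only comes before the other
    ones, and powers of [x_j] alone come first of all. *)
Definition circuit_order i j : rel 'X_{1..n} :=
  refine_order (fun u => \sum_(k | (k != i) && (k != j)) u k)%N
    (refine_order (fun u => u i) (fun u v => (u <= v)%O)).

Lemma circuit_monomial_order i j : monomial_order (circuit_order i j).
Proof.
apply: refine_monomial_order.
  by move=> u v; rewrite -big_split; apply: eq_bigr => k _; rewrite mnmDE.
apply: refine_monomial_order; last exact: deglex_monomial_order.
by move=> u v; rewrite mnmDE.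
Qed.

Variable (a : 'I_n -> nat).
Hypothesis a_gt0 : forall i, (0 < a i)%N.
Local Notation deg := (degA a).

Definition lcma i j := lcmn (a i) (a j).
Definition circuit_mnm i j : 'X_{1..n} := (U_(i) *+ (lcma i j %/ a i))%MM.

Lemma lcmaC i j : lcma i j = lcma j i. Proof. exact: lcmnC. Qed.

Lemma dvd_lcma i j : (a i %| lcma i j)%N. Proof. exact: dvdn_lcml. Qed.

Lemma lcma_gt0 i j : (0 < lcma i j)%N. Proof. by rewrite lcmn_gt0 !a_gt0. Qed.

Lemma lcma_div_gt0 i j : (0 < lcma i j %/ a i)%N.
Proof. by rewrite divn_gt0 // dvdn_leq ?lcma_gt0 ?dvd_lcma. Qed.

Lemma deg_circuit_mnm i j : deg (circuit_mnm i j) = lcma i j.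
Proof. by rewrite degAU divnK // dvd_lcma. Qed.

Lemma circuit_mnm_neq i j : i != j -> circuit_mnm i j != circuit_mnm j i.
Proof.
move=> ij; apply/eqP => /mnmP/(_ i); rewrite !mulmnE !mnm1E eqxx eq_sym (negPf ij).
by have := lcma_div_gt0 i j; lia.
Qed.

Lemma mnm_two_variables i j u : i != j -> (forall k, k != i -> k != j -> u k = 0%N) ->
  u = (U_(i) *+ u i + U_(j) *+ u j)%MM.
Proof.
move=> ij u0; apply/mnmP => k; rewrite mnmDE !mulmnE !mnm1E.
have [<-|ki] := eqVneq i k; first by rewrite eq_sym (negPf ij); lia.
have [<-|kj] := eqVneq j k; first by lia.
by rewrite u0 // eq_sym.
Qed.

(** For [circuit_order i j], the power of [x_j] is standard, being the only
    monomial of its degree free of other variables.  A smaller power of [x_i] is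
    standard: trading some of it for a power of [x_j] would require an exponent
    at least [lcma i j %/ a i]. *)
Lemma circuit_universal (K : fieldType) i j : i != j ->
  universal_groebner_basis (toric_ideal K a) ('X_[circuit_mnm i j] - 'X_[circuit_mnm j i]).
Proof.
move=> ij; have mo := circuit_monomial_order i j.
have others0 u : (\sum_(k | (k != i) && (k != j)) u k)%N = 0%N ->
    u = (U_(i) *+ u i + U_(j) *+ u j)%MM.
  move=> /eqP; rewrite sum_nat_eq0 => /forallP u0.
  apply: mnm_two_variables => // k ki kj.
  by have := u0 k; rewrite ki kj => /eqP.
have others_pure k c : k = i \/ k = j ->
    (\sum_(k' | (k' != i) && (k' != j)) (U_(k) *+ c)%MM k')%N = 0%N.
  move=> ke; rewrite big1 // => k' /andP[k'i k'j]; rewrite mulmnE mnm1E.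
  by case: ke => ->; rewrite eq_sym ?(negPf k'i) ?(negPf k'j).
have degij u : u = (U_(i) *+ u i + U_(j) *+ u j)%MM ->
    deg u = (u i * a i + u j * a j)%N.
  by move=> {1}->; rewrite degAD !degAU.
have sv : standard a (circuit_order i j) (circuit_mnm j i).
  move=> z zE; rewrite /circuit_order /refine_order others_pure; last by right.
  have [z0|//] := posnP; rewrite z0 /= mulmnE mnm1E eq_sym (negPf ij) mul0n.
  have [zi0|//] := posnP; rewrite zi0 eqxx /=.
  move: zE; rewrite deg_circuit_mnm (degij _ (others0 _ z0)) zi0 => zE.
  suff -> : z = circuit_mnm j i by rewrite Order.POrderTheory.lexx.
  rewrite (others0 _ z0) zi0 /circuit_mnm -zE mul0n add0n mulnK //.
  by rewrite mulm0n add0m.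
apply: (corner_universal K a_gt0 mo _ sv); last by rewrite !deg_circuit_mnm lcmaC.
split=> [su|z w E w0].
  have := circuit_mnm_neq ij; rewrite (standard_uniq mo su sv) ?eqxx //.
  by rewrite !deg_circuit_mnm lcmaC.
have zE : z = (U_(i) *+ z i)%MM.
  apply/mnmP => k; move/mnmP/(_ k): E; rewrite mnmDE !mulmnE !mnm1E.
  by case: eqVneq => [->|]; lia.
have zi : (z i < lcma i j %/ a i)%N.
  rewrite ltnNge; apply/negP => le_zi; move/mnmP: E => E.
  case/eqP: w0; apply/mnmP => k; have := E k; rewrite mnmDE mnm0E !mulmnE !mnm1E.
  by case: eqVneq => [<-|]; lia.
have z0 : (\sum_(k | (k != i) && (k != j)) z k)%N = 0%N.
  by rewrite zE others_pure //; left.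
move=> z' z'z; rewrite /circuit_order /refine_order z0.
have [z'0|//] := posnP; rewrite z'0 /=.
move: z'z; rewrite (degij _ (others0 _ z'0)) {1}zE degAU => degE.
rewrite /=; case: (ltngtP (z i) (z' i)) => //= [lt_z'z|eq_zz'].
  have dvd : (lcma i j %| (z i - z' i) * a i)%N.
    rewrite dvdn_lcm dvdn_mull //= mulnBl -degE addKn dvdn_mull //.
  have := dvdn_leq _ dvd; rewrite muln_gt0 a_gt0 subn_gt0 lt_z'z => /(_ isT).
  rewrite -(divnK (dvd_lcma i j)) leq_pmul2r //; lia.
suff -> : z' = z by rewrite Order.POrderTheory.lexx.
have z'j : z' j = 0%N by have := a_gt0 j; move: degE; rewrite eq_zz'; nia.
by rewrite (others0 _ z'0) z'j -eq_zz' [RHS]zE mulm0n addm0.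
Qed.

End Circuits.

(** * From robustness to equal least common multiples *)

Section Main.

Variables (K : fieldType) (n : nat) (a : 'I_n -> nat).
Hypothesis a_gt0 : forall i, (0 < a i)%N.
Implicit Types (f g h p q : {mpoly K[n]}) (G H I J M : set {mpoly K[n]}).
Implicit Types (u v w z s t : 'X_{1..n}) (P : pred 'X_{1..n}) (i j k : 'I_n).

Local Notation deg := (degA a).
Local Notation toric := (toric_ideal K a).

Lemma ltn_div_dvd d x y : (0 < d)%N -> (d %| x)%N -> (d %| y)%N -> (x < y)%N ->
  (x %/ d < y %/ d)%N.
Proof. by move=> d0 dx dy xy; rewrite -(ltn_pmul2r d0) !divnK. Qed.

Lemma leq_double_dvd d x : (d %| x)%N -> (d < x)%N -> (d + d <= x)%N.
Proof. by case/dvdnP=> [[|[|c]]] ->; rewrite ?mulSn; lia. Qed.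

Lemma pure_powerE i c : (U_(i) *+ c)%MM i = c.
Proof. by rewrite mulmnE mnm1E eqxx mul1n. Qed.

Lemma circuit_mnm_gt0 i j : (0 < circuit_mnm a i j i)%N.
Proof. by rewrite pure_powerE lcma_div_gt0. Qed.

Lemma mnm_addl_gt0 u v i : (0 < u i -> 0 < (u + v)%MM i)%N.
Proof. by rewrite mnmDE addn_gt0 => ->. Qed.

Lemma mnm_addr_gt0 u v i : (0 < v i -> 0 < (u + v)%MM i)%N.
Proof. by rewrite mnmDE addn_gt0 orbC => ->. Qed.

Lemma universal_markov_not_lower u v : u != v -> deg u = deg v ->
  sign_closure (universal_markov_basis toric) ('X_[u] - 'X_[v]) ->
  ~ lower_ideal K a (deg u) ('X_[u] - 'X_[v]).
Proof.
move=> neq_uv uv; rewrite /sign_closure /= opprB => -[] [M MM Mp].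
  exact: (markov_not_lower neq_uv MM Mp).
move=> /(ideal_sym (lower_ideal_is_ideal _ _ _)); rewrite uv.
by apply: (markov_not_lower _ MM Mp); rewrite eq_sym.
Qed.

Lemma universal_groebner_corner u v : u != v ->
  sign_closure (universal_groebner_basis toric) ('X_[u] - 'X_[v]) ->
  exists2 le, monomial_order le & corner a le u \/ standard a le u.
Proof.
move=> neq_uv [|] [le mo [G GG Gp]]; exists le => //;
  have [x [y [E _ cx sy]]] := reduced_groebner_corner a_gt0 mo GG Gp.
  by case: (eq_binomial neq_uv E) => -[-> _]; [left | right].
rewrite opprB in E; rewrite eq_sym in neq_uv.
by case: (eq_binomial neq_uv E) => -[_ ->]; [right | left].
Qed.

Section Robust.
Hypothesis robust : generalized_robust toric.

Lemma circuit_not_lower i j : i != j ->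
  ~ lower_ideal K a (lcma a i j) ('X_[circuit_mnm a i j] - 'X_[circuit_mnm a j i]).
Proof.
move=> ij; rewrite -(deg_circuit_mnm a i j); apply: universal_markov_not_lower.
- exact: circuit_mnm_neq.
- by rewrite !deg_circuit_mnm lcmaC.
by rewrite -robust; left; apply: circuit_universal.
Qed.

(** With [b] the degree of the circuit of [i] and [j], and [l < l'] those of the
    circuits of [k] with [i] and with [j], the following path in degree [l']
    joins the two monomials of the latter: start from the power of [x_k],
    replace some of it by [x_i^(l/a_i)], go to a monomial containing
    [x_i^(b/a_i)] and a power of [x_j], end with the power of [x_j]. *)
Lemma lcma_le_of_lt i j k : i != j -> i != k -> j != k ->
  (lcma a i j < lcma a j k)%N -> (lcma a j k <= lcma a i k)%N.
Proof.
move=> ij ik jk ltb; rewrite leqNgt; apply/negP => ltl.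
have lowI := lower_ideal_is_ideal K a (lcma a j k).
apply: (circuit_not_lower jk); apply: (ideal_sym lowI).
have lt_k : (lcma a k i %/ a k < lcma a k j %/ a k)%N.
  by apply: ltn_div_dvd; rewrite ?dvd_lcma // ![lcma a k _]lcmaC.
have lt_j : (lcma a j i %/ a j < lcma a j k %/ a j)%N.
  by apply: ltn_div_dvd; rewrite ?dvd_lcma // [lcma a j i]lcmaC.
have mulK x y : (lcma a x y %/ a x * a x)%N = lcma a x y by rewrite divnK ?dvd_lcma.
pose z1 := (U_(k) *+ (lcma a k j %/ a k - lcma a k i %/ a k) + circuit_mnm a i k)%MM.
pose z2 := (U_(j) *+ (lcma a j k %/ a j - lcma a j i %/ a j) + circuit_mnm a i j)%MM.
have z1E : deg z1 = lcma a j k.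
  by rewrite degAD degAU deg_circuit_mnm mulnBl !mulK ![lcma a k _]lcmaC subnK // ltnW.
have z2E : deg z2 = lcma a j k.
  by rewrite degAD degAU deg_circuit_mnm mulnBl !mulK [lcma a j i]lcmaC subnK // ltnW.
have z1k : (0 < z1 k)%N by apply: mnm_addl_gt0; rewrite pure_powerE subn_gt0.
have z2j : (0 < z2 j)%N by apply: mnm_addl_gt0; rewrite pure_powerE subn_gt0.
have z1i : (0 < z1 i)%N by apply: mnm_addr_gt0; apply: circuit_mnm_gt0.
have z2i : (0 < z2 i)%N by apply: mnm_addr_gt0; apply: circuit_mnm_gt0.
apply: (ideal_trans (v := z1) lowI).
  apply: (lower_ideal_share a_gt0 (i := k)) => //; first exact: circuit_mnm_gt0.
  by rewrite deg_circuit_mnm lcmaC.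
apply: (ideal_trans (v := z2) lowI).
  exact: (lower_ideal_share a_gt0 (i := i)).
by apply: (lower_ideal_share a_gt0 (i := j)); rewrite ?deg_circuit_mnm ?circuit_mnm_gt0.
Qed.

(** If two circuits with [x_k] had a common degree [l] above [b = lcma i j], the
    monomial [u] obtained from [x_i^(l/a_i)] by trading [x_i^(b/a_i)] for
    [x_j^(b/a_j)] would give a Markov binomial [x^u - x_k^(l/a_k)].  As
    [2 b <= l], both [x_i^(b/a_i)] and [x_j^(b/a_j)] divide [u] properly; they
    have the same degree, so they are not both standard, and [u] is neither
    standard nor a corner, for any order. *)
Lemma robust_no_gluing i j k l : i != j -> i != k -> j != k ->
  lcma a i k = l -> lcma a j k = l -> (l <= lcma a i j)%N.
Proof.
move=> ij ik jk ikl jkl; rewrite leqNgt; apply/negP => ltl.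
set b := lcma a i j in ltl.
have [ai aj] : (a i %| l)%N /\ (a j %| l)%N by rewrite -{1}ikl -jkl !dvd_lcma.
have [aib ajb] : (a i %| b)%N /\ (a j %| b)%N by rewrite /b {2}lcmaC !dvd_lcma.
have b2l : (b + b <= l)%N.
  by apply: leq_double_dvd ltl; rewrite dvdn_lcm ai aj.
have b0 : (0 < b)%N by apply: lcma_gt0.
have bi0 : (0 < b %/ a i)%N by apply: lcma_div_gt0.
have bj0 : (0 < b %/ a j)%N by rewrite /b lcmaC; apply: lcma_div_gt0.
have bl2 : (b %/ a i + b %/ a i <= l %/ a i)%N.
  by rewrite -divnDl // leq_div2r.
have : (b %/ a i < l %/ a i)%N by apply: ltn_div_dvd.
rewrite -subn_gt0 => ui.
pose u := (U_(i) *+ (l %/ a i - b %/ a i) + circuit_mnm a j i)%MM.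
have ul : deg u = l.
  by rewrite degAD degAU deg_circuit_mnm mulnBl !divnK // lcmaC subnK // ltnW.
have vl : deg (circuit_mnm a k i) = l by rewrite deg_circuit_mnm lcmaC.
have uk : u k = 0%N.
  by rewrite mnmDE !mulmnE !mnm1E (negPf ik) (negPf jk).
have neq_uv : u != circuit_mnm a k i.
  by apply/eqP => E; have := circuit_mnm_gt0 k i; rewrite -E uk.
have nlow : ~ lower_ideal K a l ('X_[u] - 'X_[circuit_mnm a k i]).
  move=> lowu; apply: (circuit_not_lower ik); rewrite ikl.
  have lowI := lower_ideal_is_ideal K a l.
  apply: (ideal_trans (v := u) lowI) => //.
  apply: (lower_ideal_share a_gt0 (i := i)) => //.
  - exact: circuit_mnm_gt0.
  - by apply: mnm_addl_gt0; rewrite pure_powerE.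
  by rewrite deg_circuit_mnm.
have := not_lower_markov a_gt0 (etrans ul (esym vl)).
rewrite ul => /(_ _ nlow)[M [MM Mp]].
have : sign_closure (universal_groebner_basis toric) ('X_[u] - 'X_[circuit_mnm a k i]).
  by rewrite robust; left; exists M.
move=> /(universal_groebner_corner neq_uv)[le mo cu].
have stdu z w : u = (z + w)%MM -> w != 0%MM -> standard a le z.
  case: cu => [[_ +]|su uE _]; first exact.
  by apply: (standard_div mo (w := w)); rewrite -uE.
have /eqP := circuit_mnm_neq a_gt0 ij; apply; apply: (standard_uniq (a := a) mo).
- apply: (stdu _ (U_(i) *+ (l %/ a i - b %/ a i - b %/ a i) + circuit_mnm a j i)%MM).
    rewrite /u addmA; congr (_ + _)%MM; apply/mnmP => k'.
    rewrite mnmDE !mulmnE -mulnDr subnKC // leq_subRL //.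
    by rewrite (leq_trans _ bl2) // leq_addr.
  rewrite -mdeg_eq0 mdegD !mdegMn !mdeg1 !mul1n addn_eq0 negb_and; apply/orP; right.
  by rewrite -lt0n lcma_div_gt0.
- apply: (stdu _ (U_(i) *+ (l %/ a i - b %/ a i))%MM); first by rewrite addmC.
  by rewrite mulmU_eq0 -lt0n.
by rewrite !deg_circuit_mnm lcmaC.
Qed.

(** The pair [i], [j] minimizes the least common multiple [b].  By the two
    previous lemmas one of the circuits of [k] with [i] and [j] has degree [b],
    so every generator divides [b], and minimality gives equality. *)
Lemma robust_lcm : exists b, forall i j, i != j -> lcma a i j = b.
Proof.
pose Q b := [exists i, exists j, (i != j) && (lcma a i j == b)].
have [exQ|nQ] := pselect (exists b, Q b); last first.
  exists 0%N => i j ij; case: nQ; exists (lcma a i j).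
  by apply/existsP; exists i; apply/existsP; exists j; rewrite ij eqxx.
have [b /existsP[i /existsP[j /andP[ij /eqP bE]]] bmin] := ex_minnP exQ.
have {}bmin k l : k != l -> (b <= lcma a k l)%N.
  move=> kl; apply: bmin.
  by apply/existsP; exists k; apply/existsP; exists l; rewrite kl eqxx.
have [ai aj] : (a i %| b)%N /\ (a j %| b)%N by rewrite -bE {2}lcmaC !dvd_lcma.
have b0 : (0 < b)%N by rewrite -bE lcma_gt0.
have dvd k l : k != l -> (a k %| b)%N -> (a l %| b)%N -> lcma a k l = b.
  move=> kl ak al; apply/eqP; rewrite eqn_leq bmin // andbT.
  by apply: dvdn_leq => //; rewrite dvdn_lcm ak.
have ak k : (a k %| b)%N.
  have [->//|ki] := eqVneq k i; have [->//|kj] := eqVneq k j.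
  have ik : i != k by rewrite eq_sym.
  have jk : j != k by rewrite eq_sym.
  suff: lcma a i k = b \/ lcma a j k = b by move=> -[] <-; rewrite lcmaC dvd_lcma.
  have lij : lcma a i k = lcma a j k -> lcma a i k = b.
    move=> E; apply/eqP; rewrite eqn_leq bmin // -bE andbT.
    exact: robust_no_gluing ij ik jk erefl (esym E).
  case: (ltngtP (lcma a i k) (lcma a j k)) => [lt|lt|/lij]; last by left.
    have [|le_b] := ltnP b (lcma a j k).
      by rewrite -bE => /(lcma_le_of_lt ij ik jk); lia.
    by right; apply/eqP; rewrite eqn_leq le_b bmin.
  have [|le_b] := ltnP b (lcma a i k).
    by rewrite -bE lcmaC eq_sym in ij * => /(lcma_le_of_lt ij jk ik); lia.
  by left; apply/eqP; rewrite eqn_leq le_b bmin.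
by exists b => k l kl; apply: dvd.
Qed.

End Robust.

(** * From a unique Betti element to equal least common multiples *)

Lemma pure_power_div i c s w : (U_(i) *+ c)%MM = (s + w)%MM -> s = (U_(i) *+ s i)%MM.
Proof.
move=> E; apply/mnmP => k; move/mnmP/(_ k): E; rewrite mnmDE !mulmnE !mnm1E.
by case: eqVneq => [->|]; lia.
Qed.

(** The singleton of one monomial of the circuit is not invariant, so some move
    of degree [b] applies to this power of [x_i]; such a move starts from a
    power of [x_i] of degree [b]. *)
Lemma unique_betti_lcm : unique_betti_element K a ->
  exists b, forall i j, i != j -> lcma a i j = b.
Proof.
move=> [M [[[MI _] _] [b Mb]]]; exists b.
have key i j : i != j -> [/\ (0 < b)%N, (a i %| b)%N & (b <= lcma a i j)%N].
  move=> ij; have : ~ invariant_under M (fun z => z == circuit_mnm a i j).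
    move=> invP.
    have := invariant_binomial (u := circuit_mnm a i j) (v := circuit_mnm a j i) invP.
    rewrite MI /= eqxx eq_sym (negPf (circuit_mnm_neq a_gt0 ij)) => E.
    suff : true = false by [].
    by apply: E; apply: toric_binomial; rewrite !deg_circuit_mnm lcmaC.
  move=> /existsNP[q /not_implyP[Mq nq]].
  have [s [t [neq_st qE sb tb]]] := Mb q Mq.
  have b0 : (0 < b)%N.
    rewrite lt0n; apply/eqP => b0; move/eqP: neq_st; apply.
    have deg0 z : deg z = b -> z = 0%MM.
      by rewrite b0 => z0; apply/eqP; apply: contraPT z0 => /(degA_gt0 a_gt0); lia.
    by rewrite (deg0 s sb) (deg0 t tb).
  have [s' [w [s'b s'w]]] : exists s' w, deg s' = b /\ circuit_mnm a i j = (s' + w)%MM.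
    apply: contrapT => nex; apply: nq; exists s, t; split=> // w.
    apply/eqP/eqP => E; case: nex; [exists s, w | exists t, w]; by rewrite ?E.
  split=> //; first by rewrite -s'b (pure_power_div s'w) degAU dvdn_mull.
  by rewrite -(deg_circuit_mnm a i j) s'w degAD s'b leq_addr.
move=> i j ij; have [b0 ai bl] := key i j ij.
have [|_ aj _] := key j i; first by rewrite eq_sym.
apply/eqP; rewrite eqn_leq bl andbT; apply: dvdn_leq => //.
by rewrite dvdn_lcm ai.
Qed.

(** * Equal least common multiples *)

Section EqualLcm.
Variable b : nat.
Hypothesis n_gt1 : (1 < n)%N.
Hypothesis lcmb : forall i j, i != j -> lcma a i j = b.
Hypothesis gcd1 : forall d, (forall i, d %| a i)%N -> d = 1%N.

Lemma exists_neq i : exists j, i != j.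
Proof.
pose i0 := Ordinal (ltnW n_gt1); pose i1 := Ordinal n_gt1.
by have [->|] := eqVneq i i0; [exists i1 | exists i0].
Qed.

Definition betti_exponent i := (b %/ a i)%N.
Definition betti_power i : 'X_{1..n} := (U_(i) *+ betti_exponent i)%MM.

Lemma betti_exponentK i : (betti_exponent i * a i)%N = b.
Proof.
have [j ij] := exists_neq i.
by rewrite /betti_exponent -(lcmb ij) divnK // dvd_lcma.
Qed.

Lemma b_gt0 : (0 < b)%N.
Proof.
by have [j /lcmb<-] := exists_neq (Ordinal n_gt1); apply: lcma_gt0.
Qed.

Lemma betti_exponent_gt0 i : (0 < betti_exponent i)%N.
Proof. by have := b_gt0; rewrite -(betti_exponentK i) muln_gt0 => /andP[]. Qed.

Lemma deg_betti_power i : deg (betti_power i) = b.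
Proof. by rewrite degAU betti_exponentK. Qed.

Lemma betti_power_circuit i j : i != j -> betti_power i = circuit_mnm a i j.
Proof. by move=> /lcmb bE; rewrite /betti_power /circuit_mnm bE. Qed.

Lemma betti_power_inj i j : betti_power i = betti_power j -> i = j.
Proof.
move=> E; apply/eqP; apply: contraT => ij.
have ji : j != i by rewrite eq_sym.
have := circuit_mnm_neq a_gt0 ij.
by rewrite -(betti_power_circuit ij) -(betti_power_circuit ji) E eqxx.
Qed.

(** A common divisor [g] of two exponents makes [b %/ g] a common multiple of
    the two generators. *)
Lemma betti_exponent_coprime i j : i != j ->
  coprime (betti_exponent i) (betti_exponent j).
Proof.
move=> ij; set g := gcdn (betti_exponent i) (betti_exponent j).
have g0 : (0 < g)%N by rewrite gcdn_gt0 betti_exponent_gt0.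
have dvdg k : (g %| betti_exponent k)%N -> (a k %| b %/ g)%N.
  case/dvdnP=> c cE; apply/dvdnP; exists c.
  by rewrite -(betti_exponentK k) cE -mulnA (mulnC g) mulnA mulnK.
have : (b %| b %/ g)%N.
  by rewrite -{1}(lcmb ij) dvdn_lcm !dvdg ?dvdn_gcdl ?dvdn_gcdr.
have gb : (g %| b)%N by rewrite -(betti_exponentK i) dvdn_mulr // dvdn_gcdl.
have bg0 : (0 < b %/ g)%N by rewrite divn_gt0 // dvdn_leq // b_gt0.
move=> /(dvdn_leq bg0); rewrite -{1}(divnK gb) /coprime -/g; nia.
Qed.

Lemma betti_exponent_dvd i j : i != j -> (betti_exponent i %| a j)%N.
Proof.
move=> ij; rewrite -(Gauss_dvdr _ (betti_exponent_coprime ij)).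
rewrite betti_exponentK -(betti_exponentK i).
exact: dvdn_mulr.
Qed.

(** The exponent of [x_i] divides all the other generators, so a divisor that
    it has in common with [a i] divides them all. *)
Lemma betti_exponent_coprime_gen i : coprime (betti_exponent i) (a i).
Proof.
apply/eqP; apply: gcd1 => j; have [<-|ij] := eqVneq i j; first exact: dvdn_gcdr.
by apply: dvdn_trans (dvdn_gcdl _ _) (betti_exponent_dvd ij).
Qed.

(** Modulo the exponent of [x_i] only the term of [x_i] survives in the degree,
    and [a i] is invertible: the exponents of [u] and [v] at [x_i] are
    congruent. *)
Lemma betti_exponent_le u v i : deg u = deg v -> (v i < u i)%N ->
  (betti_exponent i <= u i)%N.
Proof.
move=> uv vu.
have rest z : exists r, (deg z = z i * a i + betti_exponent i * r)%N.
  suff /dvdnP[r E] : (betti_exponent i %| \sum_(j | j != i) z j * a j)%N.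
    by exists r; rewrite /degA (bigD1 i) //= E (mulnC r).
  by apply: dvdn_sum => j ji; rewrite dvdn_mull // betti_exponent_dvd // eq_sym.
have [r uE] := rest u; have [r' vE] := rest v.
have : (betti_exponent i %| (u i - v i) * a i)%N.
  rewrite -(dvdn_addl (n := betti_exponent i * r)) ?dvdn_mulr //.
  have -> : ((u i - v i) * a i + betti_exponent i * r = betti_exponent i * r')%N.
    have : (v i * a i <= u i * a i)%N by rewrite leq_mul2r ltnW ?orbT.
    by move: uv; rewrite uE vE mulnBl; lia.
  exact: dvdn_mulr.
rewrite Gauss_dvdl ?betti_exponent_coprime_gen // => /dvdn_leq; lia.
Qed.

Lemma exists_larger u v : deg u = deg v -> u != v -> exists i, (v i < u i)%N.
Proof.
move=> uv neq_uv; apply: contrapT => nex.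
have le_uv : (u <= v)%MM.
  by apply/mnm_lepP => i; rewrite leqNgt; apply/negP => ?; apply: nex; exists i.
move: uv; rewrite -(submK le_uv) degAD => E.
have [w0|/(degA_gt0 a_gt0)] := eqVneq (v - u)%MM 0%MM; last by lia.
by rewrite -(submK le_uv) w0 add0m eqxx in neq_uv.
Qed.

(** Each monomial has a larger exponent than the other one at some variable. *)
Lemma fiber_powers u v : deg u = deg v -> u != v ->
  exists i j w w',
    [/\ i != j, u = (w + betti_power i)%MM & v = (w' + betti_power j)%MM].
Proof.
move=> uv neq_uv; have [i iE] := exists_larger uv neq_uv.
rewrite eq_sym in neq_uv; have [j jE] := exists_larger (esym uv) neq_uv.
have [w wE] := mnm_splitU (betti_exponent_le uv iE).
have [w' w'E] := mnm_splitU (betti_exponent_le (esym uv) jE).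
by exists i, j, w, w'; split=> //; apply/eqP => ij; subst j; lia.
Qed.

Definition betti_binomials : set {mpoly K[n]} :=
  [set p | exists i j, i != j /\ p = 'X_[betti_power i] - 'X_[betti_power j]].

(** Trading [betti_power i] for [betti_power j] in [u] creates the variable
    [x_j], which [v] also has; it can be cancelled, and the degree drops. *)
Lemma betti_binomials_generate : ideal_gen betti_binomials = toric.
Proof.
have BI : is_ideal (ideal_gen betti_binomials) by exact: ideal_gen_is_ideal.
apply/seteqP; split.
  apply: ideal_genS => [|_ [i [j [_ ->]]]]; first exact: toric_is_ideal.
  by apply: toric_binomial; rewrite !deg_betti_power.
apply: toric_genS => // u; move: {2}(deg u) (leqnn (deg u)) => e.
elim: e u => [|e IHe] u ue v uv.
all: have [->|neq_uv] := eqVneq u v; first exact: (ideal_refl _ BI).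
all: have [i [j [w [w' [ij uE vE]]]]] := fiber_powers uv neq_uv.
  by move: ue; rewrite uE degAD deg_betti_power; have := b_gt0; lia.
pose u' := (w + betti_power j)%MM.
have u'u : deg u' = deg u by rewrite uE !degAD !deg_betti_power.
apply: (ideal_trans (v := u') BI).
  rewrite uE /u' !(addmC w); apply: (ideal_shift _ BI); apply: ideal_gen_sub.
  by exists i, j.
have jpos z : (0 < (z + betti_power j)%MM j)%N.
  by rewrite mnmDE mulmnE mnm1E eqxx mul1n; have := betti_exponent_gt0 j; lia.
have [x xE] := mnm_splitU (jpos w); have [y yE] := mnm_splitU (jpos w').
have xy : deg x = deg y.
  apply/eqP; rewrite -(eqn_add2r (deg (U_(j) *+ 1)%MM)) -!degAD -xE -yE -vE -uv.
  by rewrite -/u' u'u.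
rewrite vE /u' xE yE; apply: (ideal_shift _ BI); apply: IHe => //.
by move: ue; rewrite -u'u /u' xE degAD degAU; have := a_gt0 j; lia.
Qed.

Lemma lcm_unique_betti : unique_betti_element K a.
Proof.
have [||M [MM MB]] :=
  finite_markov_basis (B := betti_binomials) _ _ betti_binomials_generate.
- apply: (finite_binomials a_gt0 (D := b)) => _ [i [j [_ ->]]].
  by exists (betti_power i), (betti_power j); rewrite !deg_betti_power.
- move=> _ [i [j [ij ->]]]; exists (betti_power i), (betti_power j); split=> //.
  by apply/eqP => /betti_power_inj/eqP; apply/negP.
exists M; split=> //; exists b => p /MB[i [j [ij ->]]].
exists (betti_power i), (betti_power j); rewrite !deg_betti_power; split=> //.
by apply/eqP => /betti_power_inj/eqP; apply/negP.
Qed.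

Lemma addm_deg0 w u : deg (w + u)%MM = deg u -> w = 0%MM.
Proof.
rewrite degAD => E; apply/eqP; apply: contraT => /(degA_gt0 a_gt0); lia.
Qed.

(** Unless [u] and [v] are [betti_power i] and [betti_power j] themselves, the
    same trade takes place in a multiple of a binomial of lower degree, and
    shows that the binomial is generated in lower degree. *)
Lemma universal_markov_betti : universal_markov_basis toric `<=` betti_binomials.
Proof.
move=> p [M MM Mp]; have [[MI _] Mbin] := MM; have [u [v [neq_uv pE]]] := Mbin p Mp.
rewrite pE in Mp *; have nlow := markov_not_lower neq_uv MM Mp.
have uv : deg u = deg v.
  by apply: (@toric_deg K _ a); rewrite -MI; apply: ideal_gen_sub.
have [i [j [w [w' [ij uE vE]]]]] := fiber_powers uv neq_uv.
have [w0|w0] := eqVneq w 0%MM.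
  have w'0 : w' = 0%MM.
    apply: (@addm_deg0 _ (betti_power j)).
    by rewrite -vE -uv uE w0 add0m !deg_betti_power.
  by exists i, j; rewrite uE vE w0 w'0 !add0m.
case: nlow; have lowI := lower_ideal_is_ideal K a (deg u).
apply: (ideal_trans (v := (w + betti_power j)%MM) lowI).
  rewrite {2}uE ![(w + _)%MM]addmC; apply: (lower_ideal_shift a_gt0) => //.
    by rewrite !deg_betti_power.
  by rewrite uE addmC.
have jpos z : (0 < (z + betti_power j)%MM j)%N.
  by rewrite mnmDE mulmnE mnm1E eqxx mul1n; have := betti_exponent_gt0 j; lia.
apply: (lower_ideal_share a_gt0 (i := j)) => //; rewrite ?vE ?jpos // -?vE //.
by rewrite uE !degAD !deg_betti_power.
Qed.

(** The two powers that divide [u] and [v] have the same degree, and the one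
    dividing [v] is standard; so the one dividing [u] is not, and the corner [u]
    equals it.  The binomial then has degree [b], below which the toric ideal
    has no nonzero element. *)
Lemma universal_groebner_markov :
  universal_groebner_basis toric `<=` universal_markov_basis toric.
Proof.
move=> p [le mo [G GG Gp]].
have [u [v [-> uv cu sv]]] := reduced_groebner_corner a_gt0 mo GG Gp.
have neq_uv : u != v by apply/eqP => E; case: cu; rewrite E.
have [i [j [w [w' [ij uE vE]]]]] := fiber_powers uv neq_uv.
have spj : standard a le (betti_power j).
  by apply: (standard_div mo (w := w')); rewrite addmC -vE.
have w0 : w = 0%MM.
  apply/eqP; apply: contraT => w0; have [_ cu'] := cu.
  have spi : standard a le (betti_power i) by apply: (cu' _ w); rewrite // addmC.
  by have /eqP := ij; rewrite (betti_power_inj (standard_uniq mo spi spj _)) ?deg_betti_power.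
have ub : deg u = b by rewrite uE w0 add0m deg_betti_power.
have [|M [MM Mp]] := not_lower_markov a_gt0 (K := K) uv; last by exists M.
have zeroI : is_ideal [set 0 : {mpoly K[n]}].
  split=> [//|x y -> ->|x y ->]; by rewrite ?addr0 ?mulr0.
move=> lowuv; have : [set 0] ('X_[u] - 'X_[v] : {mpoly K[n]}).
  apply: (lower_idealS zeroI _ lowuv) => s t st; rewrite ub => sb.
  have [->|neq_st] := eqVneq s t; first by rewrite /= subrr.
  have [i' [_ [x [_ [_ sE _]]]]] := fiber_powers st neq_st.
  by move: sb; rewrite sE degAD deg_betti_power; lia.
move=> /= E; have := mcoeff_binomial_l K neq_uv; rewrite E mcoeff0 => /esym/eqP.
by rewrite oner_eq0.
Qed.

Lemma lcm_robust : generalized_robust toric.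
Proof.
rewrite /generalized_robust; congr sign_closure; apply/seteqP; split.
  exact: universal_groebner_markov.
move=> p /universal_markov_betti[i [j [ij ->]]].
have ji : j != i by rewrite eq_sym.
by rewrite (betti_power_circuit ij) (betti_power_circuit ji); apply: circuit_universal.
Qed.

End EqualLcm.
End Main.

End ToricIdeals.

(** * Generators of a numerical semigroup *)

Section Semigroup.
Set Implicit Arguments.
Unset Strict Implicit.
Unset Printing Implicit Defensive.
Variables (S : set nat) (n : nat) (a : 'I_n -> nat).
Hypotheses (S_semigroup : numerical_semigroup S) (a_gens : minimal_generators S a).

Lemma submonoid_gen_is_submonoid (A : set nat) : is_submonoid (submonoid_gen A).
Proof.
split=> [T [[T0 _] _] // | x y Ax Ay T TP]; have [[_ TD] _] := TP.
by apply: TD; [apply: Ax | apply: Ay].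
Qed.

(** Zero is in every submonoid, so it is redundant among generators. *)
Lemma generators_gt0 i : (0 < a i)%N.
Proof.
have [_ [aS amin]] := a_gens; rewrite lt0n; apply/negP => /eqP ai0.
have E : submonoid_gen (range a `\ 0%N) = S.
  rewrite -aS; apply/seteqP; split; apply: smallest_sub.
  - exact: submonoid_gen_is_submonoid.
  - by move=> x [ax _]; apply: sub_gen_smallest.
  - exact: submonoid_gen_is_submonoid.
  move=> x ax; have [->|x0] := eqVneq x 0%N.
    by have [] := submonoid_gen_is_submonoid (range a `\ 0%N).
  by apply: sub_gen_smallest; split=> //; apply/eqP.
have : range a (a i) by exists i.
by rewrite -(amin _ (@subDsetl _ _ _) E) ai0 => -[_ []].
Qed.

(** A numerical semigroup contains two consecutive integers. *)
Lemma generators_gcd d : (forall i, d %| a i)%N -> d = 1%N.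
Proof.
have [_ [aS _]] := a_gens; have [_ /finite_seqP[r rE]] := S_semigroup => da.
have dS x : S x -> (d %| x)%N.
  rewrite -aS; apply: (@smallest_sub _ _ _ [set x | d %| x]%N).
    by split=> /= [|y z]; [exact: dvdn0 | exact: dvdn_add].
  by move=> _ [i _ <-]; apply: da.
pose N := (\max_(x <- r) x).+1.
have large x : (N <= x)%N -> S x.
  move=> Nx; apply: contrapT => nSx; have : x \in r by have : (~` S) x by []; rewrite rE.
  move=> xr; move: Nx; rewrite ltnNge => /negP; apply.
  exact: (@leq_bigmax_seq _ _ xpredT id).
have dN := dS _ (large N (leqnn _)); have := dS _ (large N.+1 (leqnSn _)).
by rewrite -addn1 dvdn_addr // dvdn1 => /eqP.
Qed.

Lemma generators_gt1 : S `<` [set: nat] -> (1 < n)%N.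
Proof.
move=> [_ ST]; rewrite ltnNge; apply/negP => n1; apply: ST => x _.
have [_ [aS _]] := a_gens; have [[S0 SD] _] := S_semigroup.
suff S1 : S 1%N by elim: x => // x Sx; rewrite -addn1; apply: SD.
have allE (i j : 'I_n) : i = j by apply: ord_inj; have := ltn_ord i; have := ltn_ord j; lia.
suff [i a1] : exists i, a i = 1%N.
  by rewrite -aS -a1; apply: sub_gen_smallest; exists i.
have [n0|n0] := posnP n.
  by suff : 2 = 1 by []; apply: generators_gcd => i; have := ltn_ord i; rewrite {2}n0.
exists (Ordinal n0); apply: generators_gcd => j.
by rewrite (allE j (Ordinal n0)).
Qed.

End Semigroup.

Theorem theorem4p12 (K : fieldType) (S : set nat)
    (S_semigroup : numerical_semigroup S) (S_proper : S `<` [set: nat])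
    (n : nat) (a : 'I_n -> nat) (a_gens : minimal_generators S a) :
  generalized_robust (toric_ideal K a) <-> unique_betti_element K a.
Proof.
have a_gt0 := generators_gt0 a_gens.
have gcd1 := generators_gcd S_semigroup a_gens.
have n_gt1 := generators_gt1 S_semigroup a_gens S_proper.
split=> [/(robust_lcm a_gt0)|/(unique_betti_lcm a_gt0)] [b lcmb].
  exact: lcm_unique_betti lcmb gcd1.
exact: lcm_robust lcmb gcd1.
Qed.
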